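(* Let $K\subset\mathbb{R}^n$ be a convex polytope with set of extreme points $V=\{v_0,\dots,v_m\}$ (the $v_k$ distinct), and let $\phi:V\to\mathbb{R}$. Let $T:\Delta_m\to K$ be the unique affine map with $T(e_k)=v_k$ for $0\le k\le m$, and define $E_{\Delta_m,\phi}:\Delta_m\to\mathbb{R}$ by $$E_{\Delta_m,\phi}(x_0,\dots,x_m)=E(x_0,\dots,x_m)+\sum_{k=0}^m x_k\,\phi(v_k).$$ Then the extremal approximately convex function $E_{K,\phi}$ on $K$ with extreme values $\phi$ is $E_{K,\phi}=T_*E_{\Delta_m,\phi}$, that is, $$E_{K,\phi}(y)=\inf\{E_{\Delta_m,\phi}(x): x\in\Delta_m,\ T(x)=y\}\qquad (y\in K).$$ Moreover, $E_{K,\phi}$ is lower semi-continuous.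
   Context: $\Delta_m=\{(x_0,\dots,x_m)\in\mathbb{R}^{m+1}:x_k\ge0,\ \sum_k x_k=1\}$ is the standard simplex with vertices $e_0,\dots,e_m$. The function $E:\Delta_m\to\mathbb{R}$ is $E(x_0,\dots,x_m)=\sum_{k=0}^m\sum_{j=0}^\infty \{2^jx_k\}/2^j$, where $\{t\}=t-[t]$ is the fractional part. A function $h$ on a convex set $C$ is approximately convex if $h\bigl(\frac{a+b}{2}\bigr)\le\frac{h(a)+h(b)}{2}+1$ for all $a,b\in C$. The extremal approximately convex function on $K$ with extreme values $\phi$ is $E_{K,\phi}(y)=\sup h(y)$, the supremum being over all bounded approximately convex functions $h:K\to\mathbb{R}$ with $h(v)\le\phi(v)$ for all $v\in V$. For a function $h$ on $\Delta_m$ bounded from below, $T_*h(y)=\inf_{T(x)=y}h(x)$. *)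

(* Defs.v *)
From HB Require Import structures.
From mathcomp Require Import all_boot all_order all_algebra.
From mathcomp Require Import all_classical all_reals all_analysis.

Set Implicit Arguments.
Unset Strict Implicit.
Unset Printing Implicit Defensive.

Import Order.TTheory GRing.Theory Num.Theory.
Import numFieldNormedType.Exports.

Local Open Scope classical_set_scope.
Local Open Scope ring_scope.
Local Open Scope convex_scope.

(* Functions on a subset C of M are represented by total functions on M; every
   notion below only looks at their values on C. *)

Section convexity.
Context {R : realType}.

Definition convex_hull {M : lmodType R} (A : set (convex_lmodType M)) :
    set (convex_lmodType M) :=
  smallest (@convex_set R M) A.

Definition polytope {M : lmodType R} (K : set (convex_lmodType M)) :=
  exists2 A : set (convex_lmodType M), finite_set A & K = convex_hull A.

Definition extreme_points {M : lmodType R} (K : set (convex_lmodType M)) :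
    set (convex_lmodType M) :=
  [set x | K x /\ forall y z (t : {i01 R}), K y -> K z ->
     0 < t%:num -> t%:num < 1 -> x = y <| t |> z -> y = z].

Definition affine_on {M N : lmodType R} (D : set (convex_lmodType M))
    (f : convex_lmodType M -> convex_lmodType N) :=
  forall t : {i01 R},
    {in D &, forall x y, f (x <| t |> y) = f x <| t |> f y}.

Definition approx_convex {M : lmodType R} (C : set M) (h : M -> R) :=
  forall a b, C a -> C b -> h (2^-1 *: (a + b)) <= (h a + h b) / 2 + 1.

(* Both the supremum here and the infimum in [pushforward_inf] are taken in the
   extended reals, where they always exist. *)
Definition extremal_approx_convex {M : lmodType R} (K : set M) (phi : M -> R)
    (y : M) : \bar R :=
  ereal_sup [set (h y)%:E | h in [set h : M -> R |
    [/\ [bounded h x | x in K], approx_convex K h &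
        forall v, extreme_points K v -> h v <= phi v]]].

Definition pushforward_inf {M N : Type} (D : set M) (T : M -> N) (h : M -> R)
    (y : N) : \bar R :=
  ereal_inf [set (h x)%:E | x in [set x | D x /\ T x = y]].

End convexity.

Section simplex.
Context {R : realType}.

Definition simplex (m : nat) : set 'rV[R]_m.+1 :=
  [set x | (forall k, 0 <= x 0 k) /\ \sum_k x 0 k = 1].

Definition simplex_vertex (m : nat) (k : 'I_m.+1) : 'rV[R]_m.+1 :=
  delta_mx 0 k.

Definition frac_part (t : R) : R := t - (Num.floor t)%:~R.

Definition simplex_E (m : nat) (x : 'rV[R]_m.+1) : R :=
  \sum_k limn (series (fun j => frac_part (2 ^+ j * x 0 k) / 2 ^+ j)).

Definition simplex_E_phi (m n : nat) (v : 'I_m.+1 -> 'rV[R]_n)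
    (phi : 'rV[R]_n -> R) (x : 'rV[R]_m.+1) : R :=
  simplex_E x + \sum_k x 0 k * phi (v k).

(* The affine maps quantified over in the theorem exist. *)
Lemma affine_vertex_map_exists (m n : nat) (v : 'I_m.+1 -> 'rV[R]_n) :
  exists T : 'rV[R]_m.+1 -> 'rV[R]_n,
    affine_on (@simplex m) T /\ forall k, T (simplex_vertex k) = v k.
Proof.
exists (fun x => \sum_k x 0 k *: v k); split=> [t x y _ _|k].
  rewrite /conv/= !scaler_sumr -big_split/=; apply: eq_bigr => k _.
  by rewrite !mxE scalerDl !scalerA.
rewrite (bigD1 k)//= big1 ?addr0 => [|i /negPf ik].
  by rewrite /simplex_vertex mxE !eqxx scale1r.
by rewrite /simplex_vertex mxE ik andbF scale0r.
Qed.

End simplex.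

Arguments simplex {R} m.

(* Main.v *)
Require Import Defs.
From HB Require Import structures.
From mathcomp Require Import all_boot all_order all_algebra.
From mathcomp Require Import all_classical all_reals all_analysis.
From mathcomp Require Import ring lra.

Import Order.TTheory GRing.Theory Num.Theory.
Import numFieldNormedType.Exports.

Local Open Scope classical_set_scope.
Local Open Scope ring_scope.

(** The two halves of the equality come from the self-similarity
    [e t = frac_part t + e (2 t) / 2] of the series [e] that [simplex_E] sums over
    the coordinates ([frac_seriesS]).

    Lower bound: the pushforward is itself a competitor in the supremum. For two
    points [x], [y] of the simplex, self-similarity at the midpoint gives a first
    term of total size at most 1 (the coordinates add up to 1) and a remainder
    [e (x_k + y_k) / 2], which is at most [(e x_k + e y_k) / 2] because the
    fractional part is subadditive. So [simplex_E] is approximately convex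
    ([simplex_E_approx_convex]), and an infimum over the fibres of an affine map
    inherits this. The fibres are nonempty because a polytope is the convex hull
    of its extreme points ([polytope_hull_extreme]).

    Upper bound: a competitor [h] is estimated at [\sum_k x_k v_k] by building
    this point from the vertices with a tournament of midpoints. Going down the
    binary expansions, at depth [j] there are [2^j] equal masses, of which
    [floor (2^j x_k)] sit at the vertex [v_k] and cost nothing; the others, of
    number [\sum_k frac_part (2^j x_k)], come from pairing masses of depth
    [j + 1] and cost 1 each, with weight [2^-j]. The total cost is
    [simplex_E x], up to an error from stopping at a finite depth, which tends to
    0 because [h] is bounded ([unit_masses], [approx_convex_le_E]).

    Semicontinuity: the fractional part only jumps downwards, so the sublevel sets
    of [simplex_E] plus a linear form are compact in the simplex
    ([simplex_E_sublevel_compact]); their images in the polytope are closed, and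
    these images are what bounds the sublevel sets of the pushforward. *)

(** * Convex sets and polytopes *)

Section convex_sets.
Context {R : realType} {M : lmodType R}.
Implicit Types (C : set M) (c d t : R) (x y p q : M).

Lemma convex_comb (C : set M) x y t : convex_set C -> C x -> C y ->
  0 <= t -> t <= 1 -> C (t *: x + (1 - t) *: y).
Proof.
move=> cC Cx Cy t0 t1.
by have := cC x y (Itv01 t0 t1) (mem_set Cx) (mem_set Cy) => /set_mem.
Qed.

Lemma convex_combP (C : set M) :
  (forall x y t, C x -> C y -> 0 <= t -> t <= 1 -> C (t *: x + (1 - t) *: y)) ->
  convex_set C.
Proof.
move=> H x y l /set_mem Cx /set_mem Cy; apply/mem_set.
exact: (H x y l%:num Cx Cy (ge0 l) (le1 l)).
Qed.

Lemma convex_midpoint (C : set M) x y : convex_set C -> C x -> C y ->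
  C (2^-1 *: (x + y)).
Proof.
move=> cC Cx Cy; have := @convex_comb C x y 2^-1 cC Cx Cy.
have -> : 1 - 2^-1 = 2^-1 :> R by lra.
by rewrite scalerDr; apply; lra.
Qed.

Lemma convex_hull_convex (A : set M) : convex_set (convex_hull A).
Proof.
apply: convex_combP => x y t Ax Ay t0 t1 B [cB AB].
by apply: convex_comb => //; [apply: Ax|apply: Ay].
Qed.

(** Points of weight [c] in the cone over [C]: working with these instead of
    normalised barycentres turns convex combinations into plain sums, with no
    division and no special treatment of vanishing weights. *)
Definition cone_at C c q := (c = 0 /\ q = 0) \/ (0 < c /\ C (c^-1 *: q)).

Lemma cone_atZ C c q t : 0 <= t -> cone_at C c q -> cone_at C (t * c) (t *: q).
Proof.
rewrite le_eqVlt => /orP[/eqP<- _|t0 [[-> ->]|[c0 Cq]]].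
- by left; rewrite mul0r scale0r.
- by left; rewrite mulr0 scaler0.
right; split; first exact: mulr_gt0.
by rewrite scalerA invfM mulrAC mulVf ?mul1r// gt_eqF.
Qed.

Lemma cone_atD C c d p q : convex_set C ->
  cone_at C c p -> cone_at C d q -> cone_at C (c + d) (p + q).
Proof.
move=> cC [[-> ->]|[c0 Cp]]; first by rewrite !add0r.
case=> [[-> ->]|[d0 Cq]]; first by rewrite !addr0; right.
right; split; first exact: addr_gt0.
have cd0 : 0 < c + d by exact: addr_gt0.
have -> : (c + d)^-1 *: (p + q) =
  (c / (c + d)) *: (c^-1 *: p) + (1 - c / (c + d)) *: (d^-1 *: q).
  rewrite !scalerA scalerDr; congr (_ *: _ + _ *: _); field.
    by rewrite !gt_eqF.
  by rewrite !gt_eqF.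
apply: convex_comb => //.
- by rewrite divr_ge0// ltW.
- by rewrite ler_pdivrMr// mul1r lerDl ltW.
Qed.

Lemma cone_at1 C q : cone_at C 1 q <-> C q.
Proof.
split=> [[[/eqP]|[_]]|Cq]; first by rewrite oner_eq0.
- by rewrite invr1 scale1r.
- by right; rewrite invr1 scale1r.
Qed.

Lemma cone_at_sum C (I : finType) (w : I -> R) (p : I -> M) : convex_set C ->
  (forall i, 0 <= w i) -> (forall i, C (p i)) ->
  cone_at C (\sum_i w i) (\sum_i w i *: p i).
Proof.
move=> cC w0 Cp.
elim/big_ind2 : _ => [||i _]; first by left.
- by move=> *; exact: cone_atD.
by rewrite -{1}[w i]mulr1; apply: cone_atZ => //; apply/cone_at1.
Qed.

Lemma convex_sum C (I : finType) (w : I -> R) (p : I -> M) : convex_set C ->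
  (forall i, 0 <= w i) -> \sum_i w i = 1 -> (forall i, C (p i)) ->
  C (\sum_i w i *: p i).
Proof. by move=> cC w0 w1 Cp; apply/cone_at1; rewrite -w1; exact: cone_at_sum. Qed.

(** The substitute for barycentric coordinates: only the weight [l] at one
    generator [a] is made explicit. The points admitting such a splitting form a
    convex set containing [s], hence contain its hull. *)
Lemma convex_hull_split (s : seq M) (a y : M) : convex_hull [set` s] y ->
  exists2 l, l <= 1 &
    cone_at (convex_hull [set` [seq x <- s | x != a]]) (1 - l) (y - l *: a).
Proof.
set H := convex_hull [set` [seq _ <- _ | _]].
have cH : convex_set H by exact: convex_hull_convex.
move=> sy; pose D := [set y | exists2 l, l <= 1 & cone_at H (1 - l) (y - l *: a)].
suff sD : convex_hull [set` s] `<=` D.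
  exact: (sD y sy).
apply: smallest_sub => {y sy}.
  apply: convex_combP => y z t [l l1 ly] [k k1 kz] t0 t1.
  have t1' : 0 <= 1 - t by lra.
  exists (t * l + (1 - t) * k); first by nra.
  have := cone_atD _ _ _ _ _ cH (cone_atZ _ _ _ _ t0 ly) (cone_atZ _ _ _ _ t1' kz).
  congr (cone_at _ _ _); first by ring.
  by rewrite !scalerBr !scalerA [(_ + _ : R) *: a]scalerDl opprD addrACA.
move=> x /= xs; have [->|xa] := eqVneq x a.
  by exists 1; [|left; rewrite subrr scale1r subrr].
exists 0; first exact: ler01.
rewrite subr0 scale0r subr0; apply/cone_at1; apply: sub_gen_smallest => /=.
by rewrite mem_filter xa.
Qed.

(** A generating set of minimal size consists of extreme points: if a generator
    [a] were interior to a segment of the polytope, the weight it has in the two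
    endpoints could not be 1 in both, and solving for [a] would put it in the
    hull of the other generators. *)
Lemma polytope_hull_extreme (K : set M) : polytope K ->
  K `<=` convex_hull (extreme_points K).
Proof.
move=> [A /finite_seqP[s0 ->] KA].
have ex : exists n, `[< exists2 s : seq M, size s = n & K = convex_hull [set` s] >].
  by exists (size s0); apply/asboolP; exists s0.
case: (ex_minnP ex) => _ /asboolP[s <- Ks] smin {ex s0 KA}.
rewrite {1}Ks; apply: smallest_sub; first exact: convex_hull_convex.
move=> a /= sa; apply: sub_gen_smallest; split.
  by rewrite Ks; exact: sub_gen_smallest.
move=> y z t; rewrite Ks => Ky Kz t0 t1 ayz.
have [l l1 ly] := convex_hull_split s a y Ky.
have [k k1 kz] := convex_hull_split s a z Kz.
set s' := [seq x <- s | x != a] in ly kz.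
set u : R := t%:num in t0 t1 ayz *.
have {}ayz : a = u *: y + (1 - u) *: z by [].
have [|ns'] := pselect (convex_hull [set` s'] a).
  (* Then [a] is redundant, against the minimality of the size of [s]. *)
  move=> Ha; suff /smin : `[< exists2 r : seq M, size r = size s' &
      K = convex_hull [set` r] >].
    rewrite size_filter leqNgt -[X in (_ < X)%N](count_predC (xpred1 a)).
    by rewrite -add1n leq_add2r -has_count has_pred1 sa.
  apply/asboolP; exists s' => //; rewrite Ks; apply/seteqP; split.
    apply: smallest_sub; first exact: convex_hull_convex.
    move=> x /= xs; have [->//|xa] := eqVneq x a.
    by apply: sub_gen_smallest; rewrite /= mem_filter xa.
  apply: smallest_sub; first exact: convex_hull_convex.
  by move=> x /=; rewrite mem_filter => /andP[_ xs]; exact: sub_gen_smallest.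
have u0 : 0 <= u by exact: ltW.
have u1 : 0 <= 1 - u by rewrite subr_ge0 ltW.
have cs' := convex_hull_convex [set` s'].
have := cone_atD _ _ _ _ _ cs' (cone_atZ _ _ _ _ u0 ly) (cone_atZ _ _ _ _ u1 kz).
(* [v] is the weight at [a] of [a] itself, as a combination of [y] and [z]. *)
pose v := u * l + (1 - u) * k.
have -> : u * (1 - l) + (1 - u) * (1 - k) = 1 - v by rewrite /v; ring.
have -> : u *: (y - l *: a) + (1 - u) *: (z - k *: a) = (1 - v) *: a.
  rewrite !scalerBr !scalerA addrACA -ayz -opprD -scalerDl -/v.
  by rewrite scalerBl scale1r.
case=> [[v1 _]|[v1]]; last by rewrite scalerA mulVf ?gt_eqF// scale1r.
have {v1} [l1' k1'] : l = 1 /\ k = 1 by rewrite /v in v1; split; nra.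
move: ly kz; rewrite l1' k1' !scale1r subrr.
case=> [[_ /subr0_eq->]|[]]; last by rewrite ltxx.
by case=> [[_ /subr0_eq->]|[]]; last by rewrite ltxx.
Qed.

End convex_sets.

(** * The fractional part series *)

Section frac_series.
Context {R : realType}.
Implicit Types s t : R.

Lemma frac_part_ge0 t : 0 <= frac_part t.
Proof. by rewrite subr_ge0 floor_le. Qed.

Lemma frac_part_lt1 t : frac_part t < 1.
Proof. by rewrite ltrBlDl -intrD1 floorD1_gt. Qed.

Lemma frac_part_le t : 0 <= t -> frac_part t <= t.
Proof. by move=> t0; rewrite gerBl ler0z floor_ge0. Qed.

Lemma frac_part_int (n : int) : frac_part (n%:~R : R) = 0.
Proof. by rewrite /frac_part intrKfloor subrr. Qed.

Lemma frac_partDint t (n : int) : frac_part (t + n%:~R) = frac_part t.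
Proof.
rewrite /frac_part floorDrz ?intr_int// intrKfloor.
by rewrite rmorphD opprD addrACA subrr addr0.
Qed.

Lemma frac_partD s t : frac_part (s + t) <= frac_part s + frac_part t.
Proof.
rewrite /frac_part addrACA -opprD lerD2l lerN2 -intrD ler_int -[leLHS](@intrKfloor R).
by apply: le_floor; rewrite intrD lerD// floor_le.
Qed.

(** Partial sums of [\sum_j frac_part (2^j t) / 2^j], i.e. of the function
    whose value at a number with binary digits [b_i] is [\sum_i i * b_i / 2^i]. *)
Definition frac_series t : R^nat := series (fun j => frac_part (2 ^+ j * t) / 2 ^+ j).

Lemma frac_series0 t : frac_series t 0%N = 0.
Proof. by rewrite /frac_series /series /= big_geq. Qed.

(** The self-similarity of the series, at the level of partial sums: this turns
    both the midpoint estimate and the upper bound into inductions. *)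
Lemma frac_seriesS t N :
  frac_series t N.+1 = frac_part t + frac_series (2 * t) N / 2.
Proof.
rewrite /frac_series /series /= big_nat_recl//= expr0 mul1r divr1; congr (_ + _).
rewrite mulr_suml; apply: eq_bigr => j _.
by rewrite exprSr invfM !mulrA.
Qed.

Lemma frac_seriesDint t (n : int) N : frac_series (t + n%:~R) N = frac_series t N.
Proof.
apply: eq_bigr => j _; congr (_ / _).
by rewrite mulrDr (_ : _ * n%:~R = (2 ^+ j * n)%:~R) ?frac_partDint// intrM rmorphXn.
Qed.

Lemma frac_series_int (n : int) N : frac_series (n%:~R : R) N = 0.
Proof.
apply: big1 => j _; rewrite (_ : _ * n%:~R = (2 ^+ j * n)%:~R).
  by rewrite frac_part_int mul0r.
by rewrite intrM rmorphXn.
Qed.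

Lemma frac_seriesD s t N : frac_series (s + t) N <= frac_series s N + frac_series t N.
Proof.
rewrite -big_split; apply: ler_sum => j _ /=.
by rewrite -mulrDl ler_wpM2r// mulrDr frac_partD.
Qed.

Lemma frac_series_nd t : {homo frac_series t : N P / (N <= P)%N >-> N <= P}.
Proof.
by apply: nondecreasing_series => j _ _; rewrite divr_ge0// frac_part_ge0.
Qed.

Lemma frac_series_ge0 t N : 0 <= frac_series t N.
Proof. by rewrite -(frac_series0 t) frac_series_nd. Qed.

Lemma frac_series_le2 t N : frac_series t N <= 2.
Proof.
elim: N t => [|N IH] t; first by rewrite frac_series0.
by rewrite frac_seriesS; have := IH (2 * t); have := frac_part_lt1 t; lra.
Qed.

Lemma frac_series_cvg t : cvgn (frac_series t).
Proof.
apply: nondecreasing_is_cvgn; first exact: frac_series_nd.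
by exists 2 => _ [N _ <-]; exact: frac_series_le2.
Qed.

End frac_series.

(** * The function [E] on the simplex *)

Section simplex_energy.
Context {R : realType} {m : nat}.
Implicit Types (x y : 'rV[R]_m.+1) (N : nat).

Lemma simplex_convex : convex_set (@simplex R m).
Proof.
apply: convex_combP => x y t [x0 x1] [y0 y1] t0 t1; split=> [k|].
  by rewrite !mxE addr_ge0// mulr_ge0// subr_ge0.
under eq_bigr do rewrite !mxE.
by rewrite big_split/= -!mulr_sumr x1 y1 !mulr1 addrC subrK.
Qed.

Lemma simplex_vertexP (k : 'I_m.+1) : simplex m (simplex_vertex k : 'rV[R]__).
Proof.
split=> [i|]; first by rewrite mxE ler0n.
rewrite (bigD1 k)//= big1 => [|i ik]; first by rewrite mxE !eqxx addr0.
by rewrite mxE eqxx (negPf ik).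
Qed.

Lemma simplex_le1 x k : simplex m x -> x 0 k <= 1.
Proof.
by case=> x0 <-; rewrite (bigD1 k)//= lerDl sumr_ge0.
Qed.

Definition simplex_E_trunc N x : R := \sum_k frac_series (x 0 k) N.

Lemma simplex_E_cvg x : simplex_E_trunc ^~ x @ \oo --> simplex_E x.
Proof.
rewrite /simplex_E_trunc /simplex_E.
by apply: cvg_big => [|k _]; [exact: add_continuous|exact: frac_series_cvg].
Qed.

Lemma simplex_E_trunc_nd x :
  {homo simplex_E_trunc ^~ x : N P / (N <= P)%N >-> N <= P}.
Proof. by move=> N P NP; apply: ler_sum => k _; exact: frac_series_nd. Qed.

(** The truncations increase to [E], so upper bounds on [E] are exactly the
    common upper bounds of the truncations; no limit is taken after this. *)
Lemma simplex_E_leP x c : simplex_E x <= c <-> forall N, simplex_E_trunc N x <= c.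
Proof.
have lE := cvg_lim (@Rhausdorff R) (simplex_E_cvg x).
have cE : cvgn (simplex_E_trunc ^~ x) by apply/cvg_ex; eexists; exact: simplex_E_cvg.
split=> [Ec N|Ec]; last by rewrite -lE; apply: limr_le => //; exact: nearW.
apply: le_trans Ec; rewrite -lE; apply: nondecreasing_cvgn_le => //.
exact: simplex_E_trunc_nd.
Qed.

Lemma simplex_E_trunc_le x N : simplex_E_trunc N x <= simplex_E x.
Proof. by have /simplex_E_leP := lexx (simplex_E x); exact. Qed.

Lemma simplex_E_ge0 x : 0 <= simplex_E x.
Proof.
apply: le_trans (simplex_E_trunc_le x 0); apply: sumr_ge0 => k _.
exact: frac_series_ge0.
Qed.

Lemma simplex_E_bound x : simplex_E x <= 2 *+ m.+1.
Proof.
apply/simplex_E_leP => N; apply: le_trans (ler_sum _ (fun k _ => frac_series_le2 _ N)) _.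
by rewrite sumr_const card_ord.
Qed.

Lemma simplex_E_vertex (k : 'I_m.+1) : simplex_E (simplex_vertex k : 'rV[R]__) = 0.
Proof.
apply/le_anti; rewrite simplex_E_ge0 andbT; apply/simplex_E_leP => N.
rewrite /simplex_E_trunc big1// => i _.
by rewrite mxE; exact: (frac_series_int (Posz _)).
Qed.

(** One unit of slack pays for the first term of the series at the midpoint,
    since the coordinates there add up to 1; the remaining terms are controlled
    by subadditivity of the fractional part. *)
Lemma simplex_E_approx_convex : approx_convex (simplex m) (@simplex_E R m).
Proof.
move=> x y sx sy; set z := 2^-1 *: (x + y).
have [z0 z1] : simplex m z by apply: convex_midpoint => //; exact: simplex_convex.
apply/simplex_E_leP => N; apply: le_trans (simplex_E_trunc_nd z _ _ (leqnSn N)) _.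
rewrite /simplex_E_trunc; under eq_bigr do rewrite frac_seriesS.
rewrite big_split/= -mulr_suml addrC; apply: lerD; last first.
  by rewrite -z1; apply: ler_sum => k _; exact: frac_part_le.
rewrite ler_wpM2r//.
apply: le_trans (lerD (simplex_E_trunc_le x N) (simplex_E_trunc_le y N)).
rewrite -big_split; apply: ler_sum => k _ /=.
by rewrite !mxE mulrA divff// mul1r frac_seriesD.
Qed.

End simplex_energy.

(** * The upper bound *)

Section upper_bound.
Context {R : realType} {M : lmodType R}.
Variables (K : set M) (h : M -> R).
Hypotheses (cK : convex_set K) (hh : approx_convex K h).

(** One round of the tournament: pairing off [2 q] points replaces them by [q]
    midpoints, and approximate convexity is used once for each of these. *)
Lemma merge_pairs q (L : seq M) : size L = q.*2 -> (forall p, p \in L -> K p) ->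
  exists L', [/\ size L' = q, forall p, p \in L' -> K p,
    \sum_(p <- L') p = 2^-1 *: \sum_(p <- L) p &
    \sum_(p <- L') h p <= (\sum_(p <- L) h p) / 2 + q%:R].
Proof.
elim: q L => [|q IH] [|a [|b L]]//= => [_ _|[sL] KL].
  by exists [::]; rewrite !big_nil scaler0 mul0r addr0.
have Ka : K a by apply: KL; rewrite mem_head.
have Kb : K b by apply: KL; rewrite !inE eqxx orbT.
have [p pL|L' [sL' KL' L'p L'h]] := IH L sL.
  by apply: KL; rewrite !inE pL !orbT.
exists (2^-1 *: (a + b) :: L'); split.
- by rewrite /= sL'.
- by move=> p; rewrite inE => /orP[/eqP->|/KL'//]; exact: convex_midpoint.
- by rewrite !big_cons L'p -scalerDr addrA.
- rewrite !big_cons -[q.+1%:R]natr1.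
  by have := hh _ _ Ka Kb; lra.
Qed.

Lemma sum_flatten_nseq (V : nmodType) (I : finType) (n : I -> nat) (p : I -> M)
    (g : M -> V) :
  \sum_(x <- flatten [seq nseq (n k) (p k) | k <- enum I]) g x =
  \sum_k g (p k) *+ n k.
Proof.
rewrite big_flatten big_map big_enum; apply: eq_bigr => k _.
by rewrite big_nseq iter_addr_0.
Qed.

(** Reading [r k] as an amount of mass at [p k], the masses [r] of integral total
    [q] can be realised by [q] unit masses in [K] whose [h]-values are controlled
    by the fractional part series. The integral parts are left at the points
    [p k] for free. The fractional parts are doubled, realised recursively, and
    the resulting unit masses are merged two by two, each merge costing 1: the
    number of merges is [\sum_k frac_part (r k)], the first term of the series.
    When the recursion stops, all the remaining mass is put at its barycentre,
    whose value is only known to be bounded; that error is halved at each level,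
    as the number of masses left never exceeds [2 * #|I|]. *)
Lemma unit_masses (I : finType) (p : I -> M) (c : I -> R) (B : R)
    (Kp : forall k, K (p k)) (hc : forall k, h (p k) <= c k) (B0 : 0 <= B)
    (hB : forall x k, K x -> h x - c k <= B) (N q : nat) (r : I -> R) :
  (q <= #|I|.*2)%N -> (forall k, 0 <= r k) -> \sum_k r k = q%:R ->
  exists L, [/\ size L = q, forall x, x \in L -> K x,
    \sum_(x <- L) x = \sum_k r k *: p k &
    \sum_(x <- L) h x <= \sum_k r k * c k + \sum_k frac_series (r k) N
                         + B * #|I|.*2%:R / 2 ^+ N].
Proof.
elim: N q r => [|N IH] q r qI r0 rq.
  have [[q0 rp]|[q0]] := cone_at_sum K I r p cK r0 Kp; rewrite rq in q0 *.
  - exists [::]; move/eqP : (q0); rewrite pnatr_eq0 => /eqP ->.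
    rewrite !big_nil rp; split=> //.
    have re0 k : r k = 0.
      by move/eqP: rq; rewrite q0 psumr_eq0// => /allP/(_ k (mem_index_enum _))/eqP.
    rewrite big1 ?add0r => [|k _]; last by rewrite re0 mul0r.
    by rewrite big1 ?add0r => [|k _]; rewrite ?frac_series0// divr_ge0// mulr_ge0.
  - set x := _ *: _ => Kx; exists (nseq q x); rewrite size_nseq; split=> //.
    + by move=> y; rewrite mem_nseq => /andP[_ /eqP->].
    + by rewrite big_nseq iter_addr_0 -scaler_nat scalerA divff ?gt_eqF// scale1r.
    rewrite big_nseq iter_addr_0.
    rewrite [X in _ <= _ + X + _]big1 => [|k _]; last by rewrite frac_series0.
    rewrite addr0 expr0 divr1 -lerBlDl -[h x *+ q]mulr_natl -rq mulr_suml -sumrB.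
    apply: (@le_trans _ _ (\sum_k r k * B)).
      by apply: ler_sum => k _; rewrite -mulrBr ler_wpM2l// hB.
    by rewrite -mulr_suml rq mulrC ler_wpM2l// ler_nat.
(* [r k >= 0], so its floor is a natural number and the absolute value only
   changes the type. *)
pose n k := `|Num.floor (r k)|%N.
have nE k : (n k)%:R = (Num.floor (r k))%:~R :> R.
  by rewrite /n -[RHS]ger0_norm ?ler0z ?floor_ge0// -intr_norm natr_absz.
have rE k : r k = (n k)%:R + frac_part (r k) by rewrite nE /frac_part addrC subrK.
have sn : \sum_k frac_part (r k) = q%:R - (\sum_k n k)%:R.
  rewrite -rq natr_sum -sumrB; apply: eq_bigr => k _.
  by rewrite {2}(rE k) addrC addKr.
have nq : (\sum_k n k <= q)%N.
  rewrite -(ler_nat R) -subr_ge0 -sn; apply: sumr_ge0 => k _.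
  exact: frac_part_ge0.
pose q' := (q - \sum_k n k)%N.
have fq : \sum_k frac_part (r k) = q'%:R by rewrite sn /q' natrB.
have q'I : (q' <= #|I|)%N.
  rewrite -(ler_nat R) -fq -[X in _ <= X%:R]sum1_card natr_sum.
  by apply: ler_sum => k _; exact/ltW/frac_part_lt1.
have [|k||L1 [sL1 KL1 L1p L1h]] := IH q'.*2 (fun k => 2 * frac_part (r k)).
- by rewrite leq_double.
- by rewrite mulr_ge0// frac_part_ge0.
- by rewrite -mulr_sumr fq -mul2n natrM.
have [L2 [sL2 KL2 L2p L2h]] := merge_pairs _ _ sL1 KL1.
exists (flatten [seq nseq (n k) (p k) | k <- enum I] ++ L2); split.
- rewrite size_cat sL2 -sum1_size sum_flatten_nseq.
  by rewrite (eq_bigr _ (fun k _ => natn (n k))) /q' subnKC.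
- move=> x; rewrite mem_cat => /orP[/flatten_mapP[k _]|/KL2//].
  by rewrite mem_nseq => /andP[_ /eqP->].
- rewrite big_cat/= sum_flatten_nseq L2p L1p scaler_sumr -big_split/=.
  apply: eq_bigr => k _.
  by rewrite !scalerA mulKf// -scaler_nat -scalerDl -rE.
rewrite big_cat/= sum_flatten_nseq.
have L0h : \sum_k h (p k) *+ n k <= \sum_k (n k)%:R * c k.
  by apply: ler_sum => k _; rewrite -[h _ *+ _]mulr_natl ler_wpM2l.
have -> : \sum_k r k * c k = \sum_k (n k)%:R * c k + \sum_k frac_part (r k) * c k.
  by rewrite -big_split; apply: eq_bigr => k _ /=; rewrite {1}(rE k) mulrDl.
have -> : \sum_k frac_series (r k) N.+1 =
    q'%:R + (\sum_k frac_series (2 * frac_part (r k)) N) / 2.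
  under eq_bigr do rewrite frac_seriesS.
  rewrite big_split/= fq mulr_suml; congr (_ + _); apply: eq_bigr => k _.
  congr (_ / _); rewrite [in LHS](rE k) mulrDr addrC.
  by rewrite -natrM (frac_seriesDint _ (Posz _)).
have E2 : \sum_k 2 * frac_part (r k) * c k = 2 * \sum_k frac_part (r k) * c k.
  by rewrite mulr_sumr; apply: eq_bigr => k _; rewrite mulrA.
rewrite E2 in L1h; rewrite exprSr invfM [B * _ * (_ * _)]mulrA; lra.
Qed.

End upper_bound.

(** A total mass of 1 is realised by a single unit mass, which has to be the
    barycentre itself; the depth [N] at which the recursion stops is then taken
    large enough to absorb the error term. *)
Lemma approx_convex_le_E {R : realType} {M : lmodType R} (m : nat) (K : set M)
    (h : M -> R) (p : 'I_m.+1 -> M) (c : 'I_m.+1 -> R) (b : R) (x : 'rV[R]_m.+1) :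
  convex_set K -> approx_convex K h -> (forall y, K y -> h y <= b) ->
  (forall k, K (p k)) -> (forall k, h (p k) <= c k) -> simplex m x ->
  h (\sum_k x 0 k *: p k) <= simplex_E x + \sum_k x 0 k * c k.
Proof.
move=> cK hh hb Kp hc [x0 x1].
(* [B] has to bound [h - c k] for every [k] and be nonnegative. *)
pose B := `|b| + \sum_k `|c k|.
have B0 : 0 <= B by rewrite addr_ge0// sumr_ge0.
have hB y k : K y -> h y - c k <= B.
  move=> /hb hy; apply: lerD; first exact: le_trans hy (ler_norm b).
  rewrite (le_trans (ler_norm _))// normrN (bigD1 k)//= lerDl.
  exact: sumr_ge0.
apply/ler_addgt0Pr => e e0.
set D := B * #|'I_m.+1|.*2%:R.
have De0 : 0 <= D / e by rewrite divr_ge0 ?mulr_ge0// ltW.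
have := upper_nthrootP (leqnn (Num.bound (D / e))).
set N := Num.bound _; rewrite ltr_pdivrMr// mulrC -ltr_pdivrMr ?exprn_gt0// => DN.
have q1 : (1 <= #|'I_m.+1|.*2)%N by rewrite card_ord doubleS.
have [[|y [|z L]] [//]] :=
  unit_masses K h cK hh _ p c B Kp hc B0 hB N 1 (x 0) q1 x0 x1.
move=> _ _; rewrite !big_seq1 -/D => -> /le_trans; apply.
apply: lerD (ltW DN); rewrite addrC lerD2r.
exact: (simplex_E_trunc_le x N).
Qed.

(** * Lower semicontinuity *)

Section lower_semicontinuity.
Context {R : realType}.

(** The jumps of the fractional part go downwards, so near any point it lies
    above the line of slope 1 through its value there. *)
Lemma frac_part_near {T : Type} (F : set_system T) {FF : Filter F} (f : T -> R) l :
  f @ F --> l -> \forall x \near F, frac_part l + (f x - l) <= frac_part (f x).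
Proof.
move=> fl; have := cvgr_lt (FF := FF) l fl (Num.floor l + 1)%:~R (floorD1_gt l).
apply: filterS => x; rewrite -floor_lt_int ltzD1 -(ler_int R) /frac_part; lra.
Qed.

Lemma frac_series_near {T : Type} (F : set_system T) {FF : Filter F} N (f : T -> R) l :
  f @ F --> l ->
  \forall x \near F, frac_series l N + N%:R * (f x - l) <= frac_series (f x) N.
Proof.
elim: N f l => [|N IH] f l fl.
  by apply: nearW => x; rewrite !frac_series0 mul0r addr0.
have f2 : (fun x => 2 * f x) @ F --> 2 * l by apply: cvgMl_tmp.
apply: filterS2 (frac_part_near F f l fl) (IH _ _ f2) => x.
by rewrite !frac_seriesS -[N.+1%:R]natr1; lra.
Qed.

Context {m : nat}.
Implicit Types x : 'rV[R]_m.+1.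

(** Within the simplex the linear error terms of the coordinates cancel, so that
    every point is a local minimum of the truncated function. *)
Lemma simplex_E_trunc_near x N : simplex m x ->
  \forall y \near x, simplex m y -> simplex_E_trunc N x <= simplex_E_trunc N y.
Proof.
move=> [_ x1].
have nx : nbhs x [set y : 'rV[R]_m.+1 | forall k,
    frac_series (x 0 k) N + N%:R * (y 0 k - x 0 k) <= frac_series (y 0 k) N].
  apply: (filter_forall (F := nbhs x)) => k.
  by apply: frac_series_near; exact: coord_continuous.
apply: filterS nx => y yx [_ y1].
apply: le_trans (ler_sum _ (fun k _ => yx k)).
by rewrite big_split/= -mulr_sumr sumrB x1 y1 subrr mulr0 addr0.
Qed.

Lemma sum_coord_continuous (c : 'I_m.+1 -> R) :
  continuous (fun x => \sum_k x 0 k * c k).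
Proof.
apply: continuous_big => [|k _ x]; first exact: add_continuous.
by apply: (cvgMr_tmp (F := nbhs x)); exact: coord_continuous.
Qed.

Lemma simplex_closed : closed (@simplex R m).
Proof.
have -> : @simplex R m = (\bigcap_k [set x : 'rV[R]_m.+1 | 0 <= x 0 k]) `&`
    (fun x : 'rV[R]_m.+1 => \sum_k x 0 k * 1) @^-1` [set 1].
  apply/seteqP; split=> x /= [x0]; rewrite -mulr_suml mulr1 => x1; split=> // k.
    by move=> _; exact: x0.
  by have := x0 k I.
apply: closedI.
  apply: closed_bigI => k _.
  apply: (@preimage_closed _ _ (fun x : 'rV[R]_m.+1 => x 0 k) [set r | 0 <= r]).
    by move=> x _; exact: coord_continuous.
  exact: closed_ge.
apply: preimage_closed => [x _|]; first exact: sum_coord_continuous.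
exact: closed_eq.
Qed.

Lemma simplex_compact : compact (@simplex R m).
Proof.
have cI := @rV_compact R m.+1 (fun _ => `[0, 1]%classic)
  (fun _ => @segment_compact R 0 1).
apply: subclosed_compact simplex_closed cI _ => x sx k /=.
by rewrite in_itv/= simplex_le1// andbT; case: sx.
Qed.

(** A sublevel set of [simplex_E] plus a linear form is the intersection of those
    obtained from the truncations, and these are closed by
    [simplex_E_trunc_near]. *)
Lemma simplex_E_sublevel_compact (c : 'I_m.+1 -> R) (a : R) :
  compact [set x | simplex m x /\ simplex_E x + \sum_k x 0 k * c k <= a].
Proof.
apply: subclosed_compact simplex_compact _ => [|x []//].
have -> : [set x | simplex m x /\ simplex_E x + \sum_k x 0 k * c k <= a] =
    \bigcap_N [set x | simplex m x /\
                       simplex_E_trunc N x <= a - \sum_k x 0 k * c k].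
  apply/seteqP; split=> x /=.
    by move=> [sx]; rewrite -lerBrDr => /simplex_E_leP H N _; split.
  move=> H; split; first by have [] := H 0%N I.
  by rewrite -lerBrDr; apply/simplex_E_leP => N; have [] := H N I.
apply: closed_bigI => N _ x clx.
have sx : simplex m x.
  by apply: simplex_closed => A /clx[y [[sy _] Ay]]; exists y.
split=> //=; rewrite leNgt; apply/negP => ax.
have gx : (fun y : 'rV[R]_m.+1 => a - \sum_k y 0 k * c k) @ x -->
    a - \sum_k x 0 k * c k.
  by apply: (cvgB (F := nbhs x)); [exact: cvg_cst|exact: sum_coord_continuous].
have /clx[y [[sy yl] /(_ sy)]] : \forall y \near x, simplex m y ->
    a - \sum_k y 0 k * c k < simplex_E_trunc N y.
  apply: filterS2 (cvgr_lt _ gx _ ax) (simplex_E_trunc_near x N sx) => y yg yE sy.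
  exact: lt_le_trans yg (yE sy).
by rewrite ltNge yl.
Qed.

End lower_semicontinuity.

(** * The pushforward to the polytope *)

Section pushforward.
Context {R : realType} {n m : nat}.
Variables (v : 'I_m.+1 -> 'rV[R]_n) (phi : 'rV[R]_n -> R).
Implicit Types x y : 'rV[R]_m.+1.

(** The points where [T] agrees with the linear map [S] form a convex set
    containing the vertices, so two-point affinity is enough. *)
Lemma affine_on_simplexE (T : 'rV[R]_m.+1 -> 'rV[R]_n) x :
  affine_on (simplex m) T -> (forall k, T (simplex_vertex k) = v k) ->
  simplex m x -> T x = \sum_k x 0 k *: v k.
Proof.
move=> aT Tv sx; pose S : 'rV[R]_m.+1 -> 'rV[R]_n := fun z => \sum_k z 0 k *: v k.
pose C := [set z | simplex m z /\ T z = S z].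
have SC (s t : R) z w : S (s *: z + t *: w) = s *: S z + t *: S w.
  rewrite /S !scaler_sumr -big_split; apply: eq_bigr => k _ /=.
  by rewrite !mxE scalerDl !scalerA.
have cC : convex_set C.
  apply: convex_combP => z w t [sz Tz] [sw Tw] t0 t1; split.
    by apply: convex_comb => //; exact: simplex_convex.
  have := aT (Itv01 t0 t1) z w (mem_set sz) (mem_set sw).
  by rewrite SC -Tz -Tw.
have xE : x = \sum_k x 0 k *: simplex_vertex k.
  exact: row_sum_delta.
suff [] : C (\sum_k x 0 k *: simplex_vertex k) by rewrite -xE.
apply: convex_sum => //; [by case: sx|by case: sx|move=> k].
split; first exact: simplex_vertexP.
rewrite Tv /S (bigD1 k)//= big1 => [|i ik]; first by rewrite mxE !eqxx scale1r addr0.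
by rewrite mxE eqxx (negPf ik) scale0r.
Qed.

Lemma simplex_E_phi_approx_convex : approx_convex (simplex m) (simplex_E_phi v phi).
Proof.
move=> x y sx sy; have := simplex_E_approx_convex _ _ sx sy; rewrite /simplex_E_phi.
have -> : \sum_k (2^-1 *: (x + y)) 0 k * phi (v k) =
    (\sum_k x 0 k * phi (v k) + \sum_k y 0 k * phi (v k)) / 2.
  rewrite -big_split mulr_suml; apply: eq_bigr => k _ /=.
  by rewrite !mxE; ring.
by lra.
Qed.

Lemma simplex_E_phi_vertex k : simplex_E_phi v phi (simplex_vertex k) = phi (v k).
Proof.
rewrite /simplex_E_phi simplex_E_vertex add0r (bigD1 k)//= big1 => [|i ik].
  by rewrite mxE !eqxx mul1r addr0.
by rewrite mxE eqxx (negPf ik) mul0r.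
Qed.

Lemma simplex_E_phi_bound : exists b, forall x, simplex m x ->
  `|simplex_E_phi v phi x| <= b.
Proof.
exists (2 *+ m.+1 + \sum_k `|phi (v k)|) => x sx.
apply: le_trans (ler_normD _ _) (lerD _ _).
  by rewrite ger0_norm ?simplex_E_ge0// simplex_E_bound.
apply: le_trans (ler_norm_sum _ _ _) (ler_sum _ _) => k _.
by rewrite normrM ger0_norm ?ler_piMl ?simplex_le1//; case: sx.
Qed.

End pushforward.

(** Points outside [K] are isolated in the topology of [subspace K], so that
    semicontinuity is only a condition at the points of [K]. *)
Lemma lower_semicontinuous_subspace {R : numFieldType} {X : topologicalType}
    (K : set X) (f : X -> \bar R) :
  (forall y a, K y -> (a%:E < f y)%E -> \forall z \near y, K z -> (a%:E < f z)%E) ->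
  lower_semicontinuous (f : subspace K -> \bar R).
Proof.
move=> H y a ay; have [Ky|nKy] := pselect (K y); last first.
  exists [set y] => [|_ ->//].
  change (nbhs_subspace (y : subspace K) [set y]).
  by rewrite -nbhs_subspace_out.
exists [set z | (a%:E < f z)%E] => //.
change (nbhs_subspace (y : subspace K) [set z | (a%:E < f z)%E]).
by rewrite -nbhs_subspace_in//; exact: H.
Qed.

Theorem theorem2p38 (R : realType) (n m : nat) (K : set 'rV[R]_n)
    (v : 'I_m.+1 -> 'rV[R]_n) (phi : 'rV[R]_n -> R)
    (T : 'rV[R]_m.+1 -> 'rV[R]_n)
    (hK : polytope K)
    (v_inj : injective v)
    (hV : extreme_points K = range v)
    (hTK : forall x, simplex m x -> K (T x))
    (hTaff : affine_on (simplex m) T)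
    (hTv : forall k, T (simplex_vertex k) = v k) :
  (forall y, K y ->
     extremal_approx_convex K phi y
     = pushforward_inf (simplex m) T (simplex_E_phi v phi) y) /\
  lower_semicontinuous
    ((fun y => extremal_approx_convex K phi y) : subspace K -> \bar R).
Proof.
have TE x : simplex m x -> T x = \sum_k x 0 k *: v k.
  exact: affine_on_simplexE.
have cK : convex_set K.
  by case: hK => A _ ->; exact: convex_hull_convex.
have sT y : K y -> exists2 x, simplex m x & T x = y.
  move=> /(polytope_hull_extreme _ hK); rewrite hV => Vy.
  have cT : convex_set (T @` simplex m).
    apply: convex_combP => _ _ t [x sx <-] [z sz <-] t0 t1.
    exists (t *: x + (1 - t) *: z); first exact: convex_comb simplex_convex _ _ _ _.
    exact: (hTaff (Itv01 t0 t1) x z (mem_set sx) (mem_set sz)).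
  have vT : range v `<=` T @` simplex m.
    by move=> _ [k _ <-]; exists (simplex_vertex k) => //; exact: simplex_vertexP.
  by have [x sx <-] := smallest_sub cT vT Vy; exists x.
have [b Eb] := simplex_E_phi_bound v phi.
set E := simplex_E_phi v phi in Eb *.
pose S y := E @` [set x | simplex m x /\ T x = y].
have Sne y : K y -> S y !=set0 by move=> /sT[x sx Tx]; exists (E x), x.
have Slb y : has_lbound (S y).
  by exists (- b) => _ [x [sx _] <-]; have := Eb x sx; rewrite ler_norml => /andP[].
(* The fibres are nonempty and [E] is bounded, so the extended infimum is a real
   one; the competitor below is the real-valued version. *)
have PE y : K y -> pushforward_inf (simplex m) T E y = (inf (S y))%:E.
  move=> Ky; rewrite -ereal_inf_EFin//; last exact: Sne.
  by rewrite /pushforward_inf /S image_comp.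
have main y : K y ->
    extremal_approx_convex K phi y = pushforward_inf (simplex m) T E y.
  move=> Ky; apply/le_anti/andP; split.
    apply: ge_ereal_sup => _ [h [hb hac hphi] <-].
    apply: le_ereal_inf_tmp => _ [x [sx <-] <-].
    have [M [_ /(_ (M + 1))hM]] := hb.
    rewrite lee_fin TE// /E /simplex_E_phi.
    apply: (approx_convex_le_E m K h v _ (M + 1)) => //.
    - move=> z Kz; apply: le_trans (ler_norm _) _; apply: hM => //.
      by rewrite ltrDl.
    - by move=> k; rewrite -hTv; apply: hTK; exact: simplex_vertexP.
    - by move=> k; apply: hphi; rewrite hV; exists k.
  (* Conversely, the pushforward is one of the functions in the supremum. *)
  rewrite PE//; apply: ereal_sup_ubound; exists (fun y => inf (S y)) => //; split.
  - exists b; split=> [|M bM z Kz /=]; first exact: num_real.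
    apply: le_trans (ltW bM); rewrite ler_norml; apply/andP; split.
      apply: lb_le_inf => [|_ [x [sx _] <-]]; first exact: Sne.
      by have := Eb x sx; rewrite ler_norml => /andP[].
    have [_ [x [sx Tx] _]] := Sne z Kz.
    apply: (@le_trans _ _ (E x)); first by apply: ge_inf => //; exists x.
    exact: le_trans (ler_norm _) (Eb x sx).
  - move=> a c Ka Kc; set z := 2^-1 *: (a + c).
    (* Solve the inequality for one infimum after the other, so that each becomes
       a lower bound to be checked on a fibre. *)
    suff H : 2 * (inf (S z) - 1) - inf (S c) <= inf (S a) by lra.
    apply: lb_le_inf => [|_ [x [sx Tx] <-]]; first exact: Sne.
    suff H : 2 * (inf (S z) - 1) - E x <= inf (S c) by lra.
    apply: lb_le_inf => [|_ [w [sw Tw] <-]]; first exact: Sne.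
    have sxw : simplex m (2^-1 *: (x + w)).
      by apply: convex_midpoint => //; exact: simplex_convex.
    have := simplex_E_phi_approx_convex v phi x w sx sw; rewrite -/E.
    suff : inf (S z) <= E (2^-1 *: (x + w)) by lra.
    apply: ge_inf => //; exists (2^-1 *: (x + w)) => //; split=> //.
    rewrite TE// /z -Tx -Tw !TE// -big_split scaler_sumr; apply: eq_bigr => k _ /=.
    by rewrite !mxE -scalerDl scalerA.
  - move=> u; rewrite hV => -[k _ <-].
    rewrite -(simplex_E_phi_vertex v phi k); apply: ge_inf => //.
    by exists (simplex_vertex k) => //; split=> //; exact: simplex_vertexP.
split=> //; apply: lower_semicontinuous_subspace => y a Ky.
rewrite main// PE// lte_fin => ay.
(* Outside the closed set [Q] all the values on a fibre exceed [c], which leaves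
   room for their infimum to stay above [a]. *)
pose c := (a + inf (S y)) / 2.
pose L : 'rV[R]_m.+1 -> 'rV[R]_n := fun x => \sum_k x 0 k *: v k.
pose Q := L @` [set x | simplex m x /\ E x <= c].
have cQ : closed Q.
  apply: compact_closed; first exact: norm_hausdorff.
  apply: continuous_compact; last exact: simplex_E_sublevel_compact.
  apply: continuous_subspaceT; apply: continuous_big => [|k _ x].
    exact: add_continuous.
  by apply: (cvgZr_tmp (F := nbhs x)); exact: coord_continuous.
have nQ : nbhs y (~` Q).
  apply: open_nbhs_nbhs; split; first exact: (closed_openC cQ).
  move=> [x [sx Ec] Lx]; suff : inf (S y) <= c by rewrite /c; lra.
  by apply: le_trans Ec; apply: ge_inf => //; exists x => //; split; rewrite ?TE.
apply: filterS nQ => z nQz Kz; rewrite main// PE// lte_fin.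
apply: (@lt_le_trans _ _ c); first by rewrite /c; lra.
apply: lb_le_inf => [|_ [x [sx Tx] <-]]; first exact: Sne.
rewrite leNgt; apply/negP => Exc; apply: nQz; exists x; last by rewrite -Tx TE.
by split=> //; exact: ltW.
Qed.
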